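(* Let $X$ be a standard measurable space and let $T : X \to X$ be a measurable map. Let $\mu$ be a $\sigma$-finite measure on $X$ for which $T$ is non-singular and ergodic. Let $m_1$ and $m_2$ be two probability measures on $X$ that are absolutely continuous with respect to $\mu$. Then $m_1$ and $m_2$ can be coupled along orbits.
   Context: A standard measurable space is a standard Borel space. The map $T$ is non-singular for $\mu$ if $\mu(T^{-1}A)=0$ whenever $A$ is measurable with $\mu(A)=0$; it is ergodic for $\mu$ if every measurable $A$ with $T^{-1}A = A$ satisfies $\mu(A)=0$ or $\mu(X\setminus A)=0$. No invariance of $\mu$ under $T$ is assumed. Coupling along orbits: let $T : X\to X$ be a measurable map on a measurable space. A coupling along orbits between two probability measures $m_1$ and $m_2$ on $X$ (or more generally between two finite measures of the same mass) is a measure $\rho$ on $X\times X$ whose marginals are respectively $m_1$ and $m_2$, and such that, for $\rho$-almost every $(x_1,x_2)$, there exist $n_1, n_2 \in \mathbb{N}=\{0,1,2,\dots\}$ with $T^{n_1}x_1 = T^{n_2}x_2$. If such a $\rho$ exists, one says that $m_1$ and $m_2$ can be coupled along orbits. *)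

(* Defs.v *)
From HB Require Import structures.
From mathcomp Require Import all_boot all_order all_algebra.
From mathcomp Require Import all_classical all_reals all_analysis.

Set Implicit Arguments.
Unset Strict Implicit.
Unset Printing Implicit Defensive.

Local Open Scope classical_set_scope.
Local Open Scope ring_scope.
Local Open Scope ereal_scope.

#[short(type="completeMetricType")]
HB.structure Definition CompleteMetric (R : numDomainType) :=
  {P of Metric R P & Complete P}.

Definition separable (P : topologicalType) : Prop :=
  exists2 D : set P, countable D & dense D.

(* X is isomorphic, as a measurable space, to a Polish space with its Borel
   sigma-algebra; [g_sigma_algebraType open] is P with that sigma-algebra. *)
Definition standard_borel (R : realType) d (X : measurableType d) : Prop :=
  exists P : completeMetricType R, separable P /\
  exists (f : X -> g_sigma_algebraType (@open P))
         (g : g_sigma_algebraType (@open P) -> X),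
    [/\ cancel f g, cancel g f,
        measurable_fun [set: X] f &
        measurable_fun [set: g_sigma_algebraType (@open P)] g].

Definition nonsingular d (X : measurableType d) (R : realType)
    (mu : {measure set X -> \bar R}) (T : X -> X) : Prop :=
  forall A : set X, measurable A -> mu A = 0 -> mu (T @^-1` A) = 0.

Definition ergodic d (X : measurableType d) (R : realType)
    (mu : {measure set X -> \bar R}) (T : X -> X) : Prop :=
  forall A : set X, measurable A -> T @^-1` A = A ->
    mu A = 0 \/ mu (~` A) = 0.

(* The marginals are compared on measurable sets only: a measure is a total
   function on sets, whose values elsewhere are irrelevant. *)
Definition is_orbit_coupling d (X : measurableType d) (R : realType)
    (T : X -> X) (m1 m2 : {measure set X -> \bar R})
    (rho : {measure set (X * X) -> \bar R}) : Prop :=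
  [/\ forall A : set X, measurable A -> pushforward rho fst A = m1 A,
      forall A : set X, measurable A -> pushforward rho snd A = m2 A &
      \forall x \ae rho, exists n1 n2 : nat, iter n1 T x.1 = iter n2 T x.2].

Definition coupled_along_orbits d (X : measurableType d) (R : realType)
    (T : X -> X) (m1 m2 : {measure set X -> \bar R}) : Prop :=
  exists rho : {measure set (X * X) -> \bar R}, is_orbit_coupling T m1 m2 rho.

(* Main.v *)
Require Import Defs.
From HB Require Import structures.
From mathcomp Require Import all_boot all_order all_algebra.
From mathcomp Require Import all_classical all_reals all_analysis.
From mathcomp Require Import measurable_realfun lra zify.

Import Order.TTheory GRing.Theory Num.Theory.
Import numFieldNormedType.Exports.

Local Open Scope classical_set_scope.
Local Open Scope ring_scope.

(* Let f = T^n and g = T^k, and let h1 and h2 be the densities with respect to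
   mu of the images of two finite measures a and b by f and g. Disintegrating a
   over f with conditional quantile functions represents a as the image, by
   some map q1, of mu x Lebesgue restricted to the region {0 <= u < h1 z}, with
   f (q1 (z, u)) = z almost everywhere; similarly for b with h2, g and q2. On
   the intersection of both regions the pair (q1, q2) couples a part of a with
   a part of b along f x = g y, and what remains of a and b is sent by f into
   {h2 < h1} and by g into {h1 < h2}, which are disjoint.
   Doing this greedily for all pairs (n, k), the residual measures of m1 and m2
   have mutually singular images by T^n and T^k for all n and k. Hence they are
   separated by a set, and, taking a limsup along the iterates, by a
   T-invariant set. Ergodicity then forces a residual measure to vanish; both
   do, since they have the same mass. *)

(** * Preimages and images of restricted measures *)

Lemma measurable_preimage {d d'} {Y : measurableType d} {Z : measurableType d'}
    (f : Y -> Z) (A : set Z) :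
  measurable_fun setT f -> measurable A -> measurable (f @^-1` A).
Proof. by move=> mf mA; rewrite -[X in measurable X]setTI; exact: mf. Qed.

(** Packages restriction followed by push-forward as a finite measure, so that Radon-Nikodym and
    uniqueness on pi-systems apply to it. *)
Lemma restr_image_measure {R : realType} {d d'} {Y : measurableType d}
    {Z : measurableType d'} (m : {measure set Y -> \bar R}) (D : set Y)
    (f : Y -> Z) :
  measurable D -> measurable_fun setT f -> (m D < +oo)%E ->
  exists nu : {finite_measure set Z -> \bar R},
    forall A, nu A = m (D `&` f @^-1` A).
Proof.
move=> mD mf Dfin.
pose nu : {measure set Z -> \bar R} :=
  measure_function_pushforward__canonical__measure_function_Measure
    (mrestr m mD) mf.
have nuE A : nu A = m (D `&` f @^-1` A) by rewrite setIC.
have nufin : fin_num_fun nu.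
  apply: lty_fin_num_fun; rewrite nuE preimage_setT setIT //.
pose nufin_mixin := Measure_isFinite.Build _ _ _ nu nufin.
pose nu' : FiniteMeasure.type Z R := HB.pack (Measure.sort nu) nufin_mixin.
by exists nu'.
Qed.

(** * Coding a standard Borel space by real numbers *)

(** The intervals from [s n] to [s n + w n] are nested, and the supremum of [s] lies in all of
    them. *)
Lemma sups0_between (R : realType) (s w : nat -> R) :
  nondecreasing_seq s -> (forall m, 0 <= w m) ->
  nonincreasing_seq (fun n => s n + w n) ->
  forall n, s n <= sups s 0 <= s n + w n.
Proof.
move=> si w0 swd n.
have ub m : s m <= s n + w n.
  rewrite (le_trans (si _ _ (leq_maxl m n)))//.
  by rewrite (le_trans _ (swd _ _ (leq_maxr m n)))// lerDl.
have hs : has_sup (sdrop s 0).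
  by split; [exists (s 0%N), 0%N|exists (s n + w n) => _ [m _ <-]].
apply/andP; split; first by apply: sup_upper_bound => //; exists n.
by apply: ge_sup; [exact: hs.1|move=> _ [m _ <-]].
Qed.

(** One real number stores membership in all the [U j], one digit for each set, and each digit can
    be read off in a Borel way. *)
Lemma measurable_coding (R : realType) d (Y : measurableType d)
    (U : nat -> set Y) : (forall j, measurable (U j)) ->
  exists (phi : Y -> R) (V : nat -> set R),
    [/\ measurable_fun setT phi, forall j, measurable (V j) &
        forall j, phi @^-1` V j = U j].
Proof.
move=> mU.
(* The largest possible tail: the sum of [4^-1 ^+ i.+1] over [i >= n]. *)
pose w n : R := 3^-1 * (4^-1) ^+ n.
have w_ge0 n : 0 <= w n by rewrite mulr_ge0 ?exprn_ge0// invr_ge0.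
have wS n : w n = 4 * w n.+1 by rewrite /w exprS; lra.
(* Base-4 expansion with digits 0 and 1: the tails stay below 1/3, so that
   every digit can be read off with a margin. *)
pose s n x : R := \sum_(i < n) \1_(U i) x * (4^-1) ^+ i.+1.
pose N n x : nat := (\sum_(i < n) (x \in U i) * 4 ^ (n - i.+1))%N.
have indE i x : \1_(U i) x = (x \in U i)%:R :> R by rewrite indicE.
have sS n x : s n.+1 x = s n x + \1_(U n) x * (4^-1) ^+ n.+1.
  by rewrite /s big_ord_recr.
have NS n x : N n.+1 x = (4 * N n x + (x \in U n))%N.
  rewrite /N big_ord_recr /= subnn expn0 muln1; congr addn.
  rewrite big_distrr /=; apply: eq_bigr => i _.
  by rewrite subSn ?ltn_ord// expnS; lia.
have sN n x : s n x = (N n x)%:R * (4^-1) ^+ n.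
  elim: n => [|n IH]; first by rewrite /s /N !big_ord0 mul0r.
  rewrite sS NS IH indE natrD natrM exprS; lra.
have snd x : nondecreasing_seq (s ^~ x).
  apply/nondecreasing_seqP => n.
  by rewrite sS lerDl mulr_ge0// exprn_ge0// invr_ge0.
have swd x : nonincreasing_seq (fun n => s n x + w n).
  apply/nonincreasing_seqP => n; rewrite sS -addrA lerD2l.
  have : \1_(U n) x <= 1 :> R by rewrite indE lern1 leq_b1.
  have : 0 <= (4^-1 : R) ^+ n by rewrite exprn_ge0// invr_ge0.
  by rewrite /w !exprS; nra.
have sph x n := @sups0_between R (s ^~ x) w (snd x) w_ge0 (swd x) n.
pose phi x := sups (s ^~ x) 0.
(* Reals whose base-4 digit of rank [j.+1] is 1. The tail is at most a third of [4^-1 ^+ j.+1], so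
   it reaches neither the open right end from digit 1 nor the left end from digit 0. *)
pose V j := \bigcup_k
  [set` `[((4 * k + 1)%N%:R : R) * 4^-1 ^+ j.+1,
          ((4 * k + 2)%N%:R : R) * 4^-1 ^+ j.+1[%R].
exists phi, V; split.
- apply: measurable_fun_sups => [x _|n].
    exists (s 0%N x + w 0%N) => _ [m _ <-].
    by have := swd x 0%N m isT; have := w_ge0 m; lra.
  apply: measurable_sum => i; exact: measurable_funM.
- by move=> j; apply: bigcup_measurable => k _; exact: measurable_itv.
move=> j; apply/seteqP; split => x; rewrite /V /phi /=; [case=> k _|move=> Ux].
- rewrite /= in_itv/= => /andP[l r].
  have /andP[] := sph x j.+1; rewrite sN /w.
  have e0 : 0 < (4^-1 : R) ^+ j.+1 by rewrite exprn_gt0// invr_gt0.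
  move: l r; move: (4^-1 ^+ j.+1) e0 => e e0 l r l' r'.
  have : ((N j.+1 x)%:R * e < (4 * k + 2)%N%:R * e) by lra.
  rewrite ltr_pM2r// ltr_nat => h1.
  have : ((4 * k + 1)%N%:R * e < ((N j.+1 x).+1)%:R * e).
    by rewrite -natr1 mulrDl mul1r; lra.
  rewrite ltr_pM2r// ltr_nat => h2.
  by apply/set_mem; move: h1 h2; rewrite NS; case: (x \in U j) => //=; lia.
- exists (N j x); rewrite /= ?in_itv/=; [by []|].
  have /andP[] := sph x j.+1; rewrite sN /w NS mem_set//.
  have e0 : 0 < (4^-1 : R) ^+ j.+1 by rewrite exprn_gt0// invr_gt0.
  move: (4^-1 ^+ j.+1) e0 => e e0 -> /= h.
  by rewrite (le_lt_trans h)// !natrD !mulrDl; lra.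
Qed.

Lemma measurable_preimage_nat d (Y : measurableType d) (f : Y -> nat) :
  (forall j, measurable (f @^-1` [set j])) ->
  forall B : set nat, measurable (f @^-1` B).
Proof.
move=> mf B; rewrite (_ : f @^-1` B = \bigcup_(j in B) f @^-1` [set j]).
  by apply: bigcup_measurable => j _; exact: mf.
by apply/seteqP; split => [y By|y [j Bj /= ->]//]; exists (f y).
Qed.

(** Taking the least index, rather than an arbitrary one, keeps the selection measurable. The
    default is a function so that a recursion can fall back on its previous value. *)
Definition first_index {Y : Type} (A : nat -> set Y) (k : Y -> nat) (y : Y) :
    nat :=
  if pselect (exists i, `[< A i y >]) is left ex then ex_minn ex else k y.

Lemma first_indexP {Y : Type} {A : nat -> set Y} (k : Y -> nat) {y : Y} :
  (exists i, A i y) -> A (first_index A k y) y.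
Proof.
move=> [i Aiy]; rewrite /first_index; case: pselect => [ex|nex].
  by case: ex_minnP => m /asboolP.
by exfalso; apply: nex; exists i; exact/asboolP.
Qed.

Lemma first_index_default {Y : Type} {A : nat -> set Y} (k : Y -> nat) {y : Y} :
  ~ (exists i, A i y) -> first_index A k y = k y.
Proof.
move=> nA; rewrite /first_index; case: pselect => // ex.
by exfalso; apply: nA; have [i /asboolP Aiy] := ex; exists i.
Qed.

Lemma measurable_first_index d (Y : measurableType d) (A : nat -> set Y)
    (k : Y -> nat) :
  (forall i, measurable (A i)) ->
  (forall B : set nat, measurable (k @^-1` B)) ->
  forall B : set nat, measurable (first_index A k @^-1` B).
Proof.
move=> mA mk; apply: measurable_preimage_nat => j.
have -> : first_index A k @^-1` [set j] =
    (A j `\` \bigcup_(i in `I_j) A i) `|`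
    (k @^-1` [set j] `\` \bigcup_i A i).
  apply/seteqP; split => y /=.
  - rewrite /first_index; case: pselect => [ex|nex].
      case: ex_minnP => m /asboolP Am le_m <-; left; split => //.
      by move=> [i /= im Ai]; have := le_m i (asboolT Ai); rewrite leqNgt im.
    move=> <-; right; split=> // -[i _ Ai].
    by apply: nex; exists i; exact/asboolP.
  - move=> [[Aj nA]|[kj nA]]; last first.
      by rewrite first_index_default// => -[i Ai]; apply: nA; exists i.
    rewrite /first_index; case: pselect => [ex|nex]; last first.
      by exfalso; apply: nex; exists j; exact/asboolP.
    case: ex_minnP => m /asboolP Am /(_ j (asboolT Aj)).
    by rewrite leq_eqVlt => /orP[/eqP//|mj]; exfalso; apply: nA; exists m.
apply: measurableU; apply: measurableD => //.
- by apply: bigcup_measurable => i _.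
- exact: bigcup_measurable.
Qed.

Lemma separable_dense_seq {P : topologicalType} (p0 : P) : separable P ->
  exists u : nat -> P, forall O : set P, open O -> O !=set0 -> exists i, O (u i).
Proof.
move=> [D /countable_injP[f finj] Dd].
(* The injection of [D] into the integers is inverted; [p0] fills the indices outside its range. *)
exists (fun n => xget p0 [set x | D x /\ f x = n]) => O oO O0.
have [x [Ox Dx]] := Dd O O0 oO.
exists (f x); case: xgetP => [y _ [Dy fy]|/(_ x)]; last by move=> [].
by rewrite (finj y x)// ?inE.
Qed.

(** [phi] records which balls of radius [2^-1 ^+ n] around a dense sequence contain the point. [psi]
    reads off one centre for each [n] and takes the limit of these centres, which exists by
    completeness. *)
Lemma polish_real_coding (R : realType) (P : completeMetricType R) (p0 : P) :
  separable P ->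
  exists (phi : g_sigma_algebraType (@open P) -> R)
         (psi : R -> g_sigma_algebraType (@open P)),
    [/\ measurable_fun setT phi, measurable_fun setT psi & cancel phi psi].
Proof.
move=> /(separable_dense_seq p0)[u ud].
pose Y := g_sigma_algebraType (@open P).
pose eps n : R := 2^-1 ^+ n.
have eps0 n : 0 < eps n by rewrite exprn_gt0.
have epsS n : eps n = 2 * eps n.+1 by rewrite /eps exprS; lra.
have eps_small e C : 0 < e -> exists n, C * eps n < e.
  have h2 : `|2^-1 : R| < 1 by rewrite ger0_norm; lra.
  move=> e0; have /cvgrPdist_lt/(_ e e0)[n _ /(_ n (leqnn n))] :=
    cvg_geometric C h2.
  by rewrite /= sub0r normrN => /ltr_normlW; exists n.
have u_near (x : P) n : exists i, (ball (u i) (eps n))° x.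
  have [|i /interior_subset xi] :=
      ud ((ball x (eps n.+1))°) (@open_interior _ _).
    by exists x; apply: nbhsx_ballx; exact: eps0.
  exists i; apply/nbhs_ballP; exists (eps n.+1) => //= y.
  move: xi; rewrite !ballEmdist/= metric_sym (epsS n).
  by have := metric_triangle (u i) x y; lra.
pose U (p : nat * nat) : set Y := (ball (u p.2) (eps p.1))°.
pose U' j := oapp U set0 (unpickle j).
have [|phi [V [mphi mV VE]]] := @measurable_coding R _ Y U'.
  move=> j; rewrite /U'; case: unpickle => [p|] //=.
  by apply: sub_sigma_algebra; exact: open_interior.
pose W (n i : nat) : set R := V (pickle (n, i)).
have WE n i : phi @^-1` W n i = U (n, i) by rewrite /W VE /U' pickleK.
(* [idx n t] codes the [n]-th approximation of the decoded point.  It keeps the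
   previous value whenever the digits of [t] would break the Cauchy estimate,
   so that the decoding is defined on all reals. *)
pose idx := fix idx n : R -> nat := match n with
  | 0 => first_index (W 0%N) (fun=> 0%N)
  | n'.+1 => first_index
     (fun i => W n i `&`
        [set t | mdist (u (idx n' t)) (u i) < 2 * eps n']) (idx n') end.
have midx n (B : set nat) : measurable (idx n @^-1` B).
  elim: n B => [|n IH] B; apply: measurable_first_index => //.
  - by move=> i; exact: mV.
  - move=> A; have [A0|A0] := pselect (A 0%N).
      by rewrite (_ : _ @^-1` A = setT)//; apply/seteqP; split.
    by rewrite (_ : _ @^-1` A = set0)//; apply/seteqP; split.
  - move=> i; apply: measurableI; first exact: mV.
    exact: (IH [set j | mdist (u j) (u i) < 2 * eps n]).
pose v n t : P := u (idx n t).
have vS n t : mdist (v n t) (v n.+1 t) <= 2 * eps n.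
  rewrite /v /=; set A := (X in first_index X).
  have [ex|nex] := pselect (exists i, A i t).
    by apply: ltW; have [_] := first_indexP (idx n) ex.
  by rewrite first_index_default// mdistxx mulr_ge0// ltW.
(* The bound is the exact sum of [2 * eps i] for [n <= i < n + m]; keeping the subtracted term makes
   the induction close. *)
have vD n m t : mdist (v n t) (v (n + m)%N t) <= 4 * eps n - 4 * eps (n + m)%N.
  elim: m => [|m IH]; first by rewrite addn0 mdistxx subrr.
  rewrite addnS; have := vS (n + m)%N t; have := epsS (n + m)%N.
  by have := metric_triangle (v n t) (v (n + m)%N t) (v (n + m).+1 t); lra.
have vD' n m t : (n <= m)%N -> mdist (v n t) (v m t) < 4 * eps n.
  by move=> /subnKC <-; have := vD n (m - n)%N t;
     have := eps0 (n + (m - n))%N; lra.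
have v_cvg t : exists l : P, v ^~ t @ \oo --> l.
  apply/cvg_ex; apply: cauchy_cvg; apply: cauchy_exP => e e0.
  have [n ne] := eps_small e 4 e0.
  exists (v n t); exists n => // m /= nm; rewrite ballEmdist /=.
  by rewrite (lt_trans (vD' _ _ _ nm)).
have [psi psiP] := choice v_cvg.
have psi_v n t : mdist (v n t) (psi t) < 5 * eps n.
  have /cvg_ballP/(_ _ (eps0 n))[N _ NP] := psiP t.
  have := NP _ (leq_maxr n N); rewrite /= ballEmdist /=.
  rewrite metric_sym => h; have := vD' _ _ t (leq_maxl n N).
  by have := metric_triangle (v n t) (v (maxn n N) t) (psi t); lra.
(* At coded points the fallback is never taken: a centre within [eps n.+1] of [x] is at distance
   less than [eps n + eps n.+1 < 2 * eps n] from the previous one. *)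
have v_phi n (x : P) : mdist (v n (phi x)) x < eps n.
  suff : W n (idx n (phi x)) (phi x).
    rewrite -[W _ _ _]/((phi @^-1` W n (idx n (phi x))) x) WE => /interior_subset.
    by rewrite ballEmdist.
  have Wnear m : exists i, W m i (phi x) /\ mdist (u i) x < eps m.
    have [i xi] := u_near x m; exists i; split.
      by rewrite -[W _ _ _]/((phi @^-1` W m i) x) WE.
    by move/interior_subset: xi; rewrite ballEmdist.
  elim: n => [|n IH].
    by apply: first_indexP; have [i [? _]] := Wnear 0%N; exists i.
  have {}IH : mdist (u (idx n (phi x))) x < eps n.
    move: IH; rewrite -[W _ _ _]/((phi @^-1` W n (idx n (phi x))) x) WE.
    by move=> /interior_subset; rewrite ballEmdist.
  rewrite /=; set A := (X in first_index X).
  suff /(first_indexP (idx n))[] : exists i, A i (phi x) by [].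
  have [i [Wi ui]] := Wnear n.+1; exists i; split => //=.
  have := metric_triangle (u (idx n (phi x))) x (u i); rewrite (metric_sym x).
  by have := epsS n; have := eps0 n.+1; lra.
exists phi, (psi : R -> Y); split => //.
- apply: measurability; first by [].
  (* Whether [psi t] lies in an open set is decided by countably many conditions on the indices.
     Since [psi t] is within [5 * eps n] of the centre, a ball of that radius around the centre
     stays within [10 * eps n] of [psi t]. *)
  move=> _ [A oA <-]; rewrite setTI (_ : _ @^-1` A =
      \bigcup_n (idx n @^-1` [set i | ball (u i) (5 * eps n) `<=` A])).
    by apply: bigcup_measurable => n _; exact: midx.
  apply/seteqP; split => t /=.
  + move=> Ot; have /nbhs_ballP[e /= e0 eO] : nbhs (psi t) A.
      exact: open_nbhs_nbhs.
    have [n ne] := eps_small e 10 e0.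
    exists n => // y; rewrite ballEmdist => vy; apply: eO; rewrite ballEmdist.
    move: vy (psi_v n t); rewrite /v /= (metric_sym _ (psi t)) => vy h.
    by have := metric_triangle (psi t) (u (idx n t)) y; lra.
  + by move=> [n _]; apply; rewrite ballEmdist; exact: psi_v.
- move=> x; apply/esym/mdist_positivity/eqP; rewrite eq_le mdist_ge0 andbT.
  apply/ler_addgt0Pl => e e0; rewrite addr0.
  have [n ne] := eps_small e 6 e0.
  have := psi_v n (phi x); have := v_phi n x; rewrite metric_sym.
  by have := metric_triangle x (v n (phi x)) (psi (phi x)); lra.
Qed.

Lemma standard_borel_real_coding {R : realType} {d} {X : measurableType d}
    (x0 : X) : standard_borel R X ->
  exists (phi : X -> R) (psi : R -> X),
    [/\ measurable_fun setT phi, measurable_fun setT psi & cancel phi psi].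
Proof.
move=> [P [sepP [f [g [fK _ mf mg]]]]].
have [phi [psi [mphi mpsi phiK]]] := polish_real_coding R P (f x0) sepP.
exists (phi \o f), (g \o psi); split; try exact: measurableT_comp.
by move=> x; rewrite /= phiK.
Qed.

(** * Conditional quantiles *)

(** The fibre over [z] has length [h z] when [h] is nonnegative, and two hypographs meet in that of
    the minimum, which is the part that can be coupled. *)
Definition hypograph {T : Type} {R : realType} (h : T -> \bar R) : set (T * R) :=
  [set y | 0 <= y.2 /\ (y.2%:E < h y.1)%E].

Lemma measurable_hypograph {R : realType} {d} {Z : measurableType d}
    (h : Z -> \bar R) : measurable_fun setT h -> measurable (hypograph h).
Proof.
move=> mh; rewrite (_ : hypograph h = [set y : Z * R | (0 <= y.2%:E)%E] `&`
   [set y | (y.2%:E < h y.1)%E]); last first.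
  by apply/seteqP; split => y []; rewrite /= lee_fin.
have m2 : measurable_fun setT (fun y : Z * R => y.2%:E : \bar R).
  by apply/measurable_EFinP; exact: measurable_snd.
apply: measurableI.
- by rewrite -[X in measurable X]setTI; exact: emeasurable_fun_c_infty.
- rewrite -[X in measurable X]setTI; apply: measurable_lte => //.
  by apply: measurableT_comp => //; exact: measurable_fst.
Qed.

Lemma measure_hypograph {R : realType} {d} {Z : measurableType d}
    (mu : {sigma_finite_measure set Z -> \bar R}) (h : Z -> \bar R) (C : set Z) :
  measurable_fun setT h -> (forall z, (0 <= h z)%E) -> measurable C ->
  (mu \x @lebesgue_measure R)%E (hypograph h `&` fst @^-1` C) =
  (\int[mu]_(z in C) h z)%E.
Proof.
move=> mh h0 mC; rewrite integral_mkcond; apply: eq_integral => z _ /=.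
rewrite patchE; case: ifPn => [/set_mem Cz|/negP Cz].
- have xE : xsection (hypograph h `&` fst @^-1` C) z =
      [set u | 0 <= u /\ (u%:E < h z)%E].
    by apply/seteqP; split => u; rewrite /xsection /= inE /hypograph /=; tauto.
  rewrite xE; move: (h z) (h0 z) => [r| |] //= r0.
  + rewrite (_ : [set u | _] = [set` `[0, r[%R]); last first.
      by apply/seteqP; split => u /=; rewrite in_itv /= lte_fin => /andP.
    rewrite lebesgue_measure_itv /= lte_fin; case: ifPn => [_|]; rewrite ?oppr0 ?adde0 //.
    by rewrite -leNgt => r0'; apply/esym/eqP; rewrite eq_le lee_fin r0' r0.
  + rewrite (_ : [set u | _] = [set` `[0, +oo[%R]); last first.
      apply/seteqP; split => u /=; rewrite in_itv /= ?andbT; first by case.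
      by move=> u0; split => //; rewrite ltry.
    by rewrite lebesgue_measure_itv /= ltry oppr0 adde0.
- rewrite (_ : xsection _ z = set0) ?measure0//.
  apply/seteqP; split => u //; rewrite /xsection /= inE => -[_ /= ?].
  by apply: Cz; rewrite inE.
Qed.

(** Radon-Nikodym for the image by [f] of [m] restricted to [B]: [r] is the conditional probability
    of [B] given [f], times the density of the image of [m]. *)
Lemma conditional_density {R : realType} {d d'} {X : measurableType d}
    {Z : measurableType d'} (mu : {sigma_finite_measure set Z -> \bar R})
    (m : {finite_measure set X -> \bar R}) (f : X -> Z) :
  measurable_fun setT f ->
  (forall C, measurable C -> mu C = 0%E -> m (f @^-1` C) = 0%E) ->
  forall B, measurable B ->
  exists r : Z -> \bar R, [/\ forall z, (0 <= r z)%E, mu.-integrable setT r &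
    forall C, measurable C -> m (B `&` f @^-1` C) = (\int[mu]_(z in C) r z)%E].
Proof.
move=> mf mac B mB.
have [|nu nuE] := restr_image_measure m B f mB mf.
  by rewrite ltey_eq fin_num_measure.
have [|r [r0 _ rint rE]] := @radon_nikodym_sigma_finite _ _ _ mu nu.
  apply/null_content_dominatesP => C mC C0; apply/eqP; rewrite nuE.
  rewrite -measure_le0 -(mac _ mC C0) le_measure ?inE//.
  - by apply: measurableI => //; exact: measurable_preimage.
  - exact: measurable_preimage.
by exists r; split => // C mC; rewrite -rE.
Qed.

(** Almost everywhere, [r'] is [r] plus the nonnegative density attached to the difference of [B']
    and [B]. *)
Lemma conditional_density_mono {R : realType} {d d'} {X : measurableType d}
    {Z : measurableType d'} (mu : {sigma_finite_measure set Z -> \bar R})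
    (m : {finite_measure set X -> \bar R}) (f : X -> Z) :
  measurable_fun setT f ->
  (forall C, measurable C -> mu C = 0%E -> m (f @^-1` C) = 0%E) ->
  forall (B B' : set X) (r r' : Z -> \bar R), measurable B -> measurable B' ->
  B `<=` B' -> mu.-integrable setT r -> mu.-integrable setT r' ->
  (forall z, (0 <= r z)%E) ->
  (forall C, measurable C -> m (B `&` f @^-1` C) = (\int[mu]_(z in C) r z)%E) ->
  (forall C, measurable C -> m (B' `&` f @^-1` C) = (\int[mu]_(z in C) r' z)%E) ->
  {ae mu, forall z, (r z <= r' z)%E}.
Proof.
move=> mf mac B B' r r' mB mB' BB' ri ri' r0 rE rE'.
have [|p [p0 pi pE]] := conditional_density mu m f mf mac (B' `\` B).
  exact: measurableD.
have : ae_eq mu setT r' (r \+ p).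
  apply: integral_ae_eq => //.
    by apply: emeasurable_funD; [exact: measurable_int ri|exact: measurable_int pi].
  move=> C _ mC.
  have mfC : measurable (f @^-1` C).
    exact: measurable_preimage.
  rewrite -rE'// ge0_integralD//; [|exact: measurable_funTS (measurable_int mu _)..].
  rewrite -rE// -pE// -measureU//; first 1 last.
  - exact: measurableI.
  - by apply: measurableI => //; exact: measurableD.
  - by apply/seteqP; split => x //= -[[Bx _] [[_ +] _]].
  - rewrite -setIUl setDE setUIr setUv setIT; congr (m (_ `&` _)).
    by apply/esym/setUidPr.
apply: filterS => z /(_ I) ->; by rewrite leeDl.
Qed.

Lemma dense_seq_between (R : realType) :
  exists t : nat -> R, forall (a : \bar R) (b : R), (a < b%:E)%E ->
    exists k, (a < (t k)%:E)%E /\ t k < b.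
Proof.
exists (fun k => ratr (odflt 0 (unpickle k))) => a b ab.
have [c ac cb] : exists2 c : R, (a <= c%:E)%E & c < b.
  case: a ab => [r| |] //= h; first by exists r.
  by exists (b - 1) => //; [rewrite leNye|rewrite ltrBlDr ltrDl].
have [q] := rat_in_itvoo cb; rewrite in_itv /= => /andP[cq qb].
exists (pickle q); rewrite pickleK /=; split => //.
by rewrite (le_lt_trans ac)// lte_fin.
Qed.

Lemma measurable_ereal_sup_range {R : realType} {d} {Y : measurableType d}
    (h : nat -> Y -> \bar R) : (forall k, measurable_fun setT (h k)) ->
  measurable_fun setT (fun y => ereal_sup (range (h ^~ y))).
Proof.
move=> mh; rewrite (_ : (fun y => _) = fun y => esups (h ^~ y) 0).
  exact: measurable_fun_esups.
apply/funext => y; rewrite /esups /=; congr ereal_sup.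
by apply/seteqP; split => _ [k _ <-]; exists k.
Qed.

(* [q (z, -)] is the conditional quantile function of [phi] given [f = z], run
   on [0 <= u < h z] with [h] the density of the image of [m] by [f]; without
   normalisation, two measures are represented over the same base. *)
Lemma quantile_representation {R : realType} {d d'} {X : measurableType d}
    {Z : measurableType d'} (mu : {sigma_finite_measure set Z -> \bar R})
    (m : {finite_measure set X -> \bar R}) (f : X -> Z)
    (phi : X -> R) (psi : R -> X) :
  measurable_fun setT f ->
  (forall C, measurable C -> mu C = 0%E -> m (f @^-1` C) = 0%E) ->
  measurable_fun setT phi -> measurable_fun setT psi -> cancel phi psi ->
  exists (h : Z -> \bar R) (q : Z * R -> X),
    [/\ measurable_fun setT h, measurable_fun setT q &
     forall C A, measurable C -> measurable A ->
       (mu \x @lebesgue_measure R)%E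
         (hypograph h `&` fst @^-1` C `&` q @^-1` A) = m (f @^-1` C `&` A)].
Proof.
move=> mf mac mphi mpsi phiK.
have [t tP] := dense_seq_between R.
pose A (s : \bar R) := [set x | (s < (phi x)%:E)%E].
have mEphi : measurable_fun setT (EFin \o phi) by exact/measurable_EFinP.
have mA s : measurable (A s).
  by rewrite -[A s]setTI; exact: emeasurable_fun_o_infty.
have mfC C : measurable C -> measurable (f @^-1` C).
  by move=> mC; exact: measurable_preimage.
have [G GP] := choice (fun s => conditional_density mu m f mf mac (A s) (mA s)).
have G0 s z : (0 <= G s z)%E by have [] := GP s.
have mG s : measurable_fun setT (G s).
  by have [_ + _] := GP s; exact: measurable_int.
have GE s C : measurable C -> (\int[mu]_(z in C) G s z)%E = m (A s `&` f @^-1` C).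
  by move=> mC; have [_ _ ->] := GP s.
(* Each [G s] is fixed only up to a null set depending on [s]. The supremum [S s] of the
   [G (t k)%:E] with [s < t k] is nonincreasing and right-continuous in [s] at every point, so it
   can be inverted pointwise. *)
pose g s k z : \bar R := if (s < (t k)%:E)%E then G (t k)%:E z else 0%E.
have g0 s k z : (0 <= g s k z)%E by rewrite /g; case: ifP.
have mg s k : measurable_fun setT (g s k) by rewrite /g; case: (s < _)%E.
pose S s z := ereal_sup (range ((g s) ^~ z)).
have mS s : measurable_fun setT (S s) by exact: measurable_ereal_sup_range.
have S_ub s k z : (g s k z <= S s z)%E by apply: ereal_sup_ubound; exists k.
have S0 s z : (0 <= S s z)%E by rewrite (le_trans (g0 s 0%N z)).
(* [S s] is still a density for [A s]. Upper bound: countably many almost everywhere comparisons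
   with [G s]. Lower bound: [A s] is exhausted by the [A (t k)%:E] with [s < t k]. *)
have SE s C : measurable C -> (\int[mu]_(z in C) S s z)%E = m (A s `&` f @^-1` C).
  move=> mC; apply/eqP; rewrite eq_le; apply/andP; split.
    rewrite -GE//; apply: ae_ge0_le_integral => //;
      [exact: measurable_funTS|exact: measurable_funTS|].
    have : {ae mu, forall z k, (g s k z <= G s z)%E}.
      apply/ae_foralln => k; rewrite /g; case: ltP => [stk|_]; last first.
        exact: aeW.
      have [? ? ?] := GP s; have [? ? ?] := GP (t k)%:E.
      apply: (conditional_density_mono mu m f mf mac (A (t k)%:E) (A s)) => //.
      by move=> x /=; apply: lt_trans.
    by apply: filterS => z gG _; apply: ge_ereal_sup => _ [k _ <-].
  pose B k := if (s < (t k)%:E)%E then A (t k)%:E `&` f @^-1` C else set0.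
  have mB k : measurable (B k).
    by rewrite /B; case: ifP => // _; apply: measurableI => //; exact: mfC.
  pose F n := \big[setU/set0]_(k < n) B k.
  have mF n : measurable (F n) by exact: bigsetU_measurable.
  (* The sets [B k] form a chain, so a finite union of them lies in a single one. *)
  have F_small n : exists k, F n `<=` B k.
    elim: n => [|n [k Fk]]; first by exists 0%N; rewrite /F big_ord0.
    rewrite /F big_ord_recr /= -/(F n).
    have [kn|nk] := leP (t k) (t n).
      have [sk|sk] := boolP (s < (t k)%:E)%E.
        exists k => x [/Fk//|]; rewrite /B sk; case: ifP => // _ [Ax fx]; split => //.
        by move: Ax; rewrite /A /= !lte_fin; exact: le_lt_trans.
      exists n => x [/Fk|//]; by rewrite /B (negbTE sk).
    have [sn|sn] := boolP (s < (t n)%:E)%E.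
      exists n => x [/Fk|//]; rewrite /B sn; case: ifP => // _ [Ax fx]; split => //.
      by move: Ax; rewrite /A /= !lte_fin; exact: lt_trans.
    exists k => x [/Fk//|]; by rewrite /B (negbTE sn).
  have FE : \bigcup_n F n = A s `&` f @^-1` C.
    apply/seteqP; split => x.
      move=> [n _]; rewrite /F -bigcup_mkord => -[k _]; rewrite /B.
      by case: ifP => // sk [Ax fx]; split => //; move: Ax; exact: lt_trans.
    move=> [Ax fx]; have [k [sk kx]] := tP _ _ Ax.
    exists k.+1 => //; rewrite /F big_ord_recr /=; right.
    by rewrite /B sk; split => //; rewrite /A /= lte_fin.
  rewrite -FE.
  have Fcvg : m \o F @ \oo --> m (\bigcup_n F n).
    apply: nondecreasing_cvg_mu => //; first exact: bigcup_measurable.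
    by move=> i j ij; apply/subsetPset; exact: subset_bigsetU.
  rewrite -(cvg_lim _ Fcvg)//; apply: lime_le; first by apply/cvg_ex; eexists; exact: Fcvg.
  apply: nearW => n /=; have [k Fk] := F_small n.
  rewrite (@le_trans _ _ (m (B k)))//; first by rewrite le_measure ?inE.
  rewrite (@le_trans _ _ (\int[mu]_(z in C) g s k z)%E)//; last first.
    by apply: ge0_le_integral => //; exact: measurable_funTS.
  rewrite /B /g; case: ifP => _; first by rewrite GE.
  by rewrite measure0 integral_ge0.
pose q' (y : Z * R) := ereal_sup (range (fun k =>
  if (y.2%:E < G (t k)%:E y.1)%E then (t k)%:E else -oo%E)).
have mq' : measurable_fun setT q'.
  apply: measurable_ereal_sup_range => k; apply: measurable_fun_ifT => //.
  apply: (measurable_fun_bool true); rewrite preimage_true.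
  apply: measurable_lte => //; last first.
    by apply: measurableT_comp => //; exact: measurable_fst.
  by apply/measurable_EFinP; exact: measurable_snd.
(* [q'] is the generalized inverse of [S] in its first argument. The sign condition prevents the
   default value 0 of [g] from exceeding [y.2]. *)
have q'_gt (s : \bar R) (y : Z * R) : 0 <= y.2 ->
    (s < q' y)%E <-> (y.2%:E < S s y.1)%E.
  move=> y0; split.
    move=> /ereal_sup_gt[_ [k _ <-]]; case: ifP => [yk sk|_]; last first.
      by rewrite ltNge leNye.
    by rewrite (lt_le_trans _ (S_ub s k _))// /g sk.
  move=> /ereal_sup_gt[_ [k _ <-]]; rewrite /g; case: ifP => [sk yk|_]; last first.
    by rewrite lte_fin ltNge y0.
  by rewrite (lt_le_trans sk)//; apply: ereal_sup_ubound; exists k => //; rewrite yk.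
(* [A -oo%E] is all of [X], so this is the density of the whole image of [m]. *)
pose h := S -oo%E.
pose D C := hypograph h `&` fst @^-1` C.
have mD C : measurable C -> measurable (D C).
  move=> mC; apply: measurableI; first exact: (measurable_hypograph _ (mS _)).
  exact: measurable_preimage.
have DE C (s : \bar R) : D C `&` [set y | (s < q' y)%E] =
    hypograph (S s) `&` fst @^-1` C.
  apply/seteqP; split => [y [[[y0 hy] Cy]] /= sy|y [[y0 sy] Cy]].
    by split => //; split=> //; apply/q'_gt.
  split; last by apply/q'_gt.
  split => //; split => //; apply/q'_gt => //.
  by apply: le_lt_trans (_ : (s < _)%E); [exact: leNye|apply/q'_gt].
have DfinE C : measurable C -> (mu \x @lebesgue_measure R)%E (D C) = m (f @^-1` C).
  move=> mC; rewrite /D /h measure_hypograph// SE//; congr (m _).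
  by apply/setIidPr => x _; rewrite /A /= ltNyr.
have mpf : measurable_fun setT (psi \o fine).
  exact: (measurableT_comp mpsi).
(* The arbitrary value of [fine] at infinity does no harm: [nu] is compared below with [kap], an
   image measure by [EFin \o phi], which charges only finite values. *)
exists h, (psi \o fine \o q'); split; [exact: mS|exact: (measurableT_comp mpf mq')|].
move=> C B mC mB.
have [|nu nuE] := restr_image_measure (mu \x @lebesgue_measure R)%E (D C) q' (mD C mC) mq'.
  by rewrite [ltLHS]DfinE// ltey_eq fin_num_measure//; exact: mfC.
have [|kap kapE] := restr_image_measure m (f @^-1` C) _ (mfC C mC) mEphi.
  by rewrite ltey_eq fin_num_measure//; exact: mfC.
(* [setT] is added because the rays do not cover [-oo]. *)
pose rays := [set B : set (\bar R) |
  B = setT \/ exists s : \bar R, B = [set x | (s < x)%E]].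
(* On the ray above [s], [DE] turns the left side into the mass under the graph of [S s], which [SE]
   computes. Rays form a pi-system, so the equality extends. *)
have : nu ((psi \o fine) @^-1` B) = kap ((psi \o fine) @^-1` B).
  apply: (measure_unique rays (fun=> setT)).
  - apply/seteqP; split.
      rewrite [X in X `<=` _](ErealGenOInfty.measurableE R).
      apply: sub_sigma_algebra2 => _ [s ->]; right; exists s%:E.
      by apply/seteqP; split => x /=; rewrite in_itv /= andbT.
    apply: smallest_sub; first exact: sigma_algebra_measurable.
    move=> _ [->|[s ->]]; first exact: measurableT.
    by rewrite -[X in measurable X]setTI; exact: emeasurable_fun_o_infty.
  - move=> U V [->|[s ->]] [->|[s' ->]]; rewrite ?setTI ?setIT;
      [left|right; eexists|right; eexists|right] => //.
    exists (maxe s s'); apply/seteqP; split => x /=; rewrite gt_max.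
      by move=> [-> ->].
    by move=> /andP.
  - by move=> _; left.
  - by rewrite bigcup_const.
  - move=> U [->|[s ->]]; rewrite [LHS]nuE [RHS]kapE.
      by rewrite !preimage_setT !setIT; exact: DfinE.
    by rewrite DE [LHS]measure_hypograph// SE// setIC.
  - by move=> k; rewrite ltey_eq fin_num_measure.
  - exact: measurable_preimage.
rewrite nuE kapE => ->; congr (m (_ `&` _)).
by apply/seteqP; split => x /=; rewrite phiK.
Qed.

(** * Coupling over a common image *)

Lemma separating_rays {R : realType} (u v : R) (t : nat -> R) :
  (forall (a : \bar R) (b : R), (a < b%:E)%E ->
    exists k, (a < (t k)%:E)%E /\ t k < b) ->
  u != v -> exists k, (u < t k /\ t k <= v) \/ (v < t k /\ t k <= u).
Proof.
move=> tP; rewrite neq_lt => /orP[|] uv.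
- have [|k [uk kv]] := tP u%:E v; first by rewrite lte_fin.
  by exists k; left; split; [rewrite -lte_fin|exact: ltW].
- have [|k [uk kv]] := tP v%:E u; first by rewrite lte_fin.
  by exists k; right; split; [rewrite -lte_fin|exact: ltW].
Qed.

Lemma measurable_neq {R : realType} {d} {Y : measurableType d} (u v : Y -> R) :
  measurable_fun setT u -> measurable_fun setT v ->
  measurable [set y | u y != v y].
Proof.
move=> mu mv; rewrite (_ : [set _ | _] = ~` [set y | u y == v y]).
  apply: measurableC.
  have := measurable_fun_eqr mu mv.
  move=> /(_ measurableT [set true]); rewrite setTI; exact.
by apply/seteqP; split => y /= /negP.
Qed.

(** On [D], the pair of [pr] and [q] is distributed as [(f x, x)] under [a], so for each [C] it is a
    null event that [pr] is in [C] and [f \o q] is not. Countably many rays suffice to detect a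
    difference seen by [phi]. *)
Lemma null_off_fiber {R : realType} {d d'} {X : measurableType d}
    {Y : measurableType d'} (phi : X -> R) (nu : {measure set Y -> \bar R})
    (a : {finite_measure set X -> \bar R}) (f : X -> X) (pr q : Y -> X) D :
  measurable_fun setT phi -> measurable_fun setT f ->
  measurable_fun setT pr -> measurable_fun setT q -> measurable D ->
  (forall C A, measurable C -> measurable A ->
     nu (D `&` pr @^-1` C `&` q @^-1` A) = a (f @^-1` C `&` A)) ->
  nu (D `&` [set y | phi (f (q y)) != phi (pr y)]) = 0%E.
Proof.
move=> mphi mf mpr mq mD nuE; have [t tP] := dense_seq_between R.
pose W k := phi @^-1` [set` `]-oo, t k[%R].
have mW k : measurable (W k) by exact: measurable_preimage.
pose E C := D `&` pr @^-1` C `&` q @^-1` (f @^-1` (~` C)).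
have E0 C : measurable C -> nu.-negligible (E C).
  move=> mC.
  have mfC : measurable (f @^-1` (~` C)).
    by apply: measurable_preimage => //; exact: measurableC.
  exists (E C); split; last by [].
    apply: measurableI; last exact: measurable_preimage.
    by apply: measurableI => //; exact: measurable_preimage.
  by rewrite (nuE _ _ mC mfC) preimage_setC setICr measure0.
have mN : measurable (D `&` [set y | phi (f (q y)) != phi (pr y)]).
  apply: measurableI => //; apply: measurable_neq.
    by apply: measurableT_comp => //; exact: measurableT_comp.
  exact: measurableT_comp.
apply/negligibleP => //.
apply: (@negligibleS _ _ _ nu (\bigcup_k (E (W k) `|` E (~` W k)))); last first.
  apply: negligible_bigcup => k; apply: negligibleU; apply: E0 => //.
  exact: measurableC.
move=> y [Dy /= /(separating_rays _ _ _ tP)[k [[ltk gek]|[ltk gek]]]]; exists k => //.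
- right; split; [split => //=|]; rewrite /W /= in_itv /=.
    by rewrite ltNge gek.
  by move=> nlt; apply: nlt.
- left; split; [split => //=|]; rewrite /W /= in_itv /=.
  by rewrite ltNge gek.
Qed.

(** [rho] is the image of the overlap of [D1] and [D2] by [(q1, q2)], where [f \o q1] and [g \o q2]
    both agree with [pr] through [phi]. The two differences give the residues, which lie over the
    complement of [S] and over [S]. *)
Lemma coupling_over_base {R : realType} {d d'} {X : measurableType d}
    {Y : measurableType d'} (nu : {measure set Y -> \bar R})
    (a b : {finite_measure set X -> \bar R}) (f g : X -> X)
    (pr q1 q2 : Y -> X) (D1 D2 : set Y) (S : set X) (phi : X -> R) :
  measurable_fun setT phi -> measurable_fun setT f -> measurable_fun setT g ->
  measurable_fun setT pr -> measurable_fun setT q1 -> measurable_fun setT q2 ->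
  measurable D1 -> measurable D2 -> measurable S ->
  (forall C A, measurable C -> measurable A ->
     nu (D1 `&` pr @^-1` C `&` q1 @^-1` A) = a (f @^-1` C `&` A)) ->
  (forall C A, measurable C -> measurable A ->
     nu (D2 `&` pr @^-1` C `&` q2 @^-1` A) = b (g @^-1` C `&` A)) ->
  D1 `\` D2 `<=` pr @^-1` (~` S) -> D2 `\` D1 `<=` pr @^-1` S ->
  exists (rho : {finite_measure set (X * X)%type -> \bar R})
         (a' b' : {finite_measure set X -> \bar R}),
    [/\ forall A, measurable A -> a A = (rho (fst @^-1` A) + a' A)%E,
        forall A, measurable A -> b A = (rho (snd @^-1` A) + b' A)%E,
        rho [set p | phi (f p.1) != phi (g p.2)] = 0%E,
        a' (f @^-1` S) = 0%E & b' (g @^-1` (~` S)) = 0%E].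
Proof.
move=> mphi mf mg mpr mq1 mq2 mD1 mD2 mS E1 E2 D12 D21.
have E1' A : measurable A -> nu (D1 `&` q1 @^-1` A) = a A.
  by move=> mA; rewrite -[A in RHS]setTI -(preimage_setT f) -E1// preimage_setT setIT.
have E2' A : measurable A -> nu (D2 `&` q2 @^-1` A) = b A.
  by move=> mA; rewrite -[A in RHS]setTI -(preimage_setT g) -E2// preimage_setT setIT.
have fin1 : (nu D1 < +oo)%E.
  rewrite -[D1]setIT -(preimage_setT q1) E1'//.
  by rewrite ltey_eq fin_num_measure.
have fin2 : (nu D2 < +oo)%E.
  rewrite -[D2]setIT -(preimage_setT q2) E2'//.
  by rewrite ltey_eq fin_num_measure.
have finS D D' : measurable D -> measurable D' -> D `<=` D' ->
    (nu D' < +oo)%E -> (nu D < +oo)%E.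
  by move=> mD mD' DD'; apply: le_lt_trans; rewrite le_measure ?inE.
pose q y := (q1 y, q2 y).
have mq : measurable_fun setT q by exact: measurable_fun_pair.
have mI : measurable (D1 `&` D2) by exact: measurableI.
have m12 : measurable (D1 `\` D2) by exact: measurableD.
have m21 : measurable (D2 `\` D1) by exact: measurableD.
have [|rho rhoE] := restr_image_measure nu (D1 `&` D2) q mI mq.
  exact: finS fin1.
have [|a' a'E] := restr_image_measure nu (D1 `\` D2) q1 m12 mq1.
  exact: finS fin1.
have [|b' b'E] := restr_image_measure nu (D2 `\` D1) q2 m21 mq2.
  exact: finS fin2.
exists rho, a', b'; split => //.
- move=> A mA; rewrite rhoE a'E -E1'// -measureU//.
  + by rewrite -setIUl setUIDK.
  + by apply: measurableI => //; exact: (measurable_preimage q1).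
  + by apply: measurableI => //; exact: (measurable_preimage q1).
  + by apply/seteqP; split => y //= -[[[_ ?] _] [[_ ?] _]].
- move=> A mA; rewrite rhoE b'E -E2'// -measureU//.
  + by rewrite [D1 `&` D2]setIC -setIUl setUIDK.
  + by apply: measurableI => //; exact: (measurable_preimage q2).
  + by apply: measurableI => //; exact: (measurable_preimage q2).
  + by apply/seteqP; split => y //= -[[[? _] _] [[_ ?] _]].
- have N1 := null_off_fiber phi nu a f pr q1 D1 mphi mf mpr mq1 mD1 E1.
  have N2 := null_off_fiber phi nu b g pr q2 D2 mphi mg mpr mq2 mD2 E2.
  have mN1 : measurable [set y | phi (f (q1 y)) != phi (pr y)].
    apply: measurable_neq; apply: measurableT_comp => //.
    exact: measurableT_comp.
  have mN2 : measurable [set y | phi (g (q2 y)) != phi (pr y)].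
    apply: measurable_neq; apply: measurableT_comp => //.
    exact: measurableT_comp.
  have mN : measurable [set p : (X * X)%type | phi (f p.1) != phi (g p.2)].
    by apply: measurable_neq; apply: measurableT_comp => //;
      exact: measurableT_comp.
  rewrite rhoE; apply/negligibleP.
    by apply: measurableI => //; exact: measurable_preimage.
  apply: (@negligibleS _ _ _ nu ((D1 `&` [set y | phi (f (q1 y)) != phi (pr y)])
     `|` (D2 `&` [set y | phi (g (q2 y)) != phi (pr y)]))); last first.
    by apply: negligibleU; apply/negligibleP => //; exact: measurableI.
  move=> y [[D1y D2y] fg].
  have [e|ne] := eqVneq (phi (f (q1 y))) (phi (pr y)); last by left.
  by right; split => //=; rewrite eq_sym -e.
- rewrite a'E; apply/eqP; rewrite -measure_le0.
  have mfS : measurable (f @^-1` S) by exact: measurable_preimage.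
  have mSC : measurable (~` S) by exact: measurableC.
  have a0 : nu (D1 `&` pr @^-1` (~` S) `&` q1 @^-1` (f @^-1` S)) = 0%E.
    by rewrite E1// -preimage_setC setICl measure0.
  rewrite -a0 le_measure ?inE//.
  + by apply: measurableI => //; exact: measurable_preimage.
  + by apply: measurableI; [apply: measurableI => //|]; exact: measurable_preimage.
  + by move=> y [Dy Sy]; split => //; split; [exact: Dy.1|exact: D12].
- rewrite b'E; apply/eqP; rewrite -measure_le0.
  have mSC : measurable (~` S) by exact: measurableC.
  have mgS : measurable (g @^-1` (~` S)) by exact: measurable_preimage.
  have b0 : nu (D2 `&` pr @^-1` S `&` q2 @^-1` (g @^-1` (~` S))) = 0%E.
    by rewrite E2// -preimage_setC setICr measure0.
  rewrite -b0 le_measure ?inE//.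
  + by apply: measurableI => //; exact: measurable_preimage.
  + by apply: measurableI; [apply: measurableI => //|]; exact: measurable_preimage.
  + by move=> y [Dy Sy]; split => //; split; [exact: Dy.1|exact: D21].
Qed.

Lemma partial_coupling {R : realType} {d} {X : measurableType d}
    (mu : {sigma_finite_measure set X -> \bar R})
    (a b : {finite_measure set X -> \bar R})
    (f g : X -> X) (phi : X -> R) (psi : R -> X) :
  measurable_fun setT phi -> measurable_fun setT psi -> cancel phi psi ->
  measurable_fun setT f -> measurable_fun setT g ->
  (forall C, measurable C -> mu C = 0%E -> a (f @^-1` C) = 0%E) ->
  (forall C, measurable C -> mu C = 0%E -> b (g @^-1` C) = 0%E) ->
  exists (rho : {finite_measure set (X * X)%type -> \bar R})
         (a' b' : {finite_measure set X -> \bar R}) (S : set X),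
    [/\ measurable S,
        forall A, measurable A -> a A = (rho (fst @^-1` A) + a' A)%E,
        forall A, measurable A -> b A = (rho (snd @^-1` A) + b' A)%E,
        rho [set p | phi (f p.1) != phi (g p.2)] = 0%E &
        a' (f @^-1` S) = 0%E /\ b' (g @^-1` (~` S)) = 0%E].
Proof.
move=> mphi mpsi phiK mf mg fac gac.
have [h1 [q1 [mh1 mq1 E1]]] :=
  quantile_representation mu a f phi psi mf fac mphi mpsi phiK.
have [h2 [q2 [mh2 mq2 E2]]] :=
  quantile_representation mu b g phi psi mg gac mphi mpsi phiK.
(* Over a point of [S] the fibre of the first hypograph is contained in that of the second, and
   conversely off [S]. *)
pose S := [set z | (h1 z <= h2 z)%E].
have mS : measurable S.
  by rewrite -[S]setTI; exact: measurable_lee.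
have [||rho [a' [b' [aE bE rho0 a0 b0]]]] := coupling_over_base
  (mu \x @lebesgue_measure R)%E a b f g fst q1 q2 (hypograph h1) (hypograph h2) S phi mphi mf mg measurable_fst mq1 mq2
  (measurable_hypograph h1 mh1) (measurable_hypograph h2 mh2) mS E1 E2.
- move=> y [[y0 yh1] yh2] /= h12; apply: yh2; split => //.
  exact: lt_le_trans h12.
- move=> y [[y0 yh2] yh1] /=; rewrite /S /= leNgt; apply/negP => h21.
  by apply: yh1; split => //; exact: lt_trans h21.
- by exists rho, a', b', S.
Qed.

(** * Exhaustion *)

(** The deficit of [nu] below [m] is additive and nonnegative, so if it vanishes on [B] it vanishes
    on every measurable part of [B]. Finiteness of [m] permits the cancellation. *)
Lemma measure_eq_sub {R : realType} {d} {X : measurableType d}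
    (m : {finite_measure set X -> \bar R}) (nu : {measure set X -> \bar R}) :
  (forall A, measurable A -> (nu A <= m A)%E) ->
  forall A B, measurable A -> measurable B -> A `<=` B ->
  nu B = m B -> nu A = m A.
Proof.
move=> le_num A B mA mB AB nuB; apply/eqP; rewrite eq_le le_num//=.
have mD : measurable (B `\` A) by exact: measurableD.
have mE : m B = (m A + m (B `\` A))%E.
  rewrite -measureU//; last by rewrite setDIK.
  by rewrite setDUK.
have nE : nu B = (nu A + nu (B `\` A))%E.
  rewrite -measureU//; last by rewrite setDIK.
  by rewrite setDUK.
have fD : m (B `\` A) \is a fin_num by exact: fin_num_measure.
by rewrite -(leeD2rE _ _ fD) -mE -nuB nE leeD2l// le_num.
Qed.

(** The union is cut into disjoint pieces, each inside some [E i] and hence without deficit. *)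
Lemma measure_eq_bigcup {R : realType} {d} {X : measurableType d}
    (m : {finite_measure set X -> \bar R}) (nu : {measure set X -> \bar R}) :
  (forall A, measurable A -> (nu A <= m A)%E) ->
  forall E : nat -> set X, (forall i, measurable (E i)) ->
  (forall i, nu (E i) = m (E i)) -> nu (\bigcup_i E i) = m (\bigcup_i E i).
Proof.
move=> le_num E mE nuE.
have mD i : measurable (seqDU E i).
  by apply: measurableD => //; exact: bigsetU_measurable.
rewrite seqDU_bigcup_eq !measure_bigcup//; [|exact: trivIset_seqDU..].
apply: eq_eseriesr => i _.
by apply: (measure_eq_sub m nu le_num _ (E i)) => //; exact: subset_seqDU.
Qed.

(** [B] consists of the points whose orbit visits [A] infinitely often; applying [T] only shifts the
    visiting times by one. *)
Lemma limsup_preimage_invariant {X : Type} (T : X -> X) (A : set X) :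
  let B := \bigcap_N \bigcup_(i in [set i | (N <= i)%N]) (iter i T @^-1` A) in
  T @^-1` B = B.
Proof.
move=> B; apply/seteqP; split => x Bx N _ /=.
- have [i /= Ni Ai] := Bx N I.
  by exists i.+1; rewrite /= ?(leq_trans Ni)// -iterS iterSr.
(* Asking for a time beyond [N.+1] makes [i] a successor, so that one step can be removed. *)
- have [i /= Ni Ai] := Bx N.+1 I.
  case: i Ni Ai => // i Ni; rewrite /= -iterS iterSr => Ai.
  by exists i.
Qed.

Lemma measurable_iter {d} {X : measurableType d} (T : X -> X) n :
  measurable_fun setT T -> measurable_fun setT (iter n T).
Proof.
move=> mT; elim: n => [|n IH]; first exact: measurable_id.
exact: (measurableT_comp mT IH).
Qed.

Lemma nonsingular_iter {R : realType} {d} {X : measurableType d}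
    (mu : {measure set X -> \bar R}) (T : X -> X) n :
  measurable_fun setT T -> nonsingular mu T ->
  forall C, measurable C -> mu C = 0%E -> mu (iter n T @^-1` C) = 0%E.
Proof.
move=> mT nsT; elim: n => [//|n IH] C mC C0.
exact: (IH (T @^-1` C) (measurable_preimage _ _ mT mC) (nsT C mC C0)).
Qed.

(** Each stage couples part of the residues of the previous one. Residues only decrease, so they
    stay null on [mu]-null sets; [state] carries this property because the next stage needs it. *)
Lemma partial_coupling_seq {R : realType} {d} {X : measurableType d}
    (mu : {sigma_finite_measure set X -> \bar R})
    (m1 m2 : {finite_measure set X -> \bar R})
    (f g : nat -> X -> X) (phi : X -> R) (psi : R -> X) :
  measurable_fun setT phi -> measurable_fun setT psi -> cancel phi psi ->
  (forall j, measurable_fun setT (f j)) -> (forall j, measurable_fun setT (g j)) ->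
  (forall j C, measurable C -> mu C = 0%E -> mu (f j @^-1` C) = 0%E) ->
  (forall j C, measurable C -> mu C = 0%E -> mu (g j @^-1` C) = 0%E) ->
  (forall C, measurable C -> mu C = 0%E -> m1 C = 0%E) ->
  (forall C, measurable C -> mu C = 0%E -> m2 C = 0%E) ->
  exists (rho : nat -> {finite_measure set (X * X)%type -> \bar R})
         (a b : nat -> {finite_measure set X -> \bar R}) (S : nat -> set X),
    [/\ [/\ a 0%N = m1, b 0%N = m2 & forall j, measurable (S j)],
        forall j A, measurable A -> a j A = (rho j (fst @^-1` A) + a j.+1 A)%E,
        forall j A, measurable A -> b j A = (rho j (snd @^-1` A) + b j.+1 A)%E,
        forall j, rho j [set p | phi (f j p.1) != phi (g j p.2)] = 0%E &
        forall j, a j.+1 (f j @^-1` S j) = 0%E /\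
                  b j.+1 (g j @^-1` (~` S j)) = 0%E].
Proof.
move=> mphi mpsi phiK mf mg fns gns ac1 ac2.
pose FM := {finite_measure set X -> \bar R}.
pose ac (m : FM) := forall C, measurable C -> mu C = 0%E -> m C = 0%E.
pose state := sig (fun ab : (FM * FM)%type => ac ab.1 /\ ac ab.2).
pose good j (s : state)
    (y : ({finite_measure set (X * X)%type -> \bar R} * state * set X)%type) :=
  let a := (sval s).1 in let b := (sval s).2 in
  let a' := (sval y.1.2).1 in let b' := (sval y.1.2).2 in
  [/\ measurable y.2,
      forall A, measurable A -> a A = (y.1.1 (fst @^-1` A) + a' A)%E,
      forall A, measurable A -> b A = (y.1.1 (snd @^-1` A) + b' A)%E,
      y.1.1 [set p | phi (f j p.1) != phi (g j p.2)] = 0%E &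
      a' (f j @^-1` y.2) = 0%E /\ b' (g j @^-1` (~` y.2)) = 0%E].
have step (js : (nat * state)%type) : exists y, good js.1 js.2 y.
  case: js => j [[a b] /= [aca acb]].
  have [|| rho [a' [b' [S [mS aE bE rho0 ab0]]]]] := partial_coupling mu a b
      (f j) (g j) phi psi mphi mpsi phiK (mf j) (mg j).
  - move=> C mC C0; apply: aca; last exact: fns.
    exact: measurable_preimage.
  - move=> C mC C0; apply: acb; last exact: gns.
    exact: measurable_preimage.
  have aca' : ac a'.
    move=> C mC C0; apply/eqP; rewrite -measure_le0 -(aca _ mC C0).
    by rewrite [leRHS]aE// leeDr.
  have acb' : ac b'.
    move=> C mC C0; apply/eqP; rewrite -measure_le0 -(acb _ mC C0).
    by rewrite [leRHS]bE// leeDr.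
  by exists (rho, exist _ (a', b') (conj aca' acb'), S).
have [F FP] := choice step.
pose s := fix s j : state :=
  if j is j'.+1 then (F (j', s j')).1.2 else exist _ (m1, m2) (conj ac1 ac2).
exists (fun j => (F (j, s j)).1.1), (fun j => (sval (s j)).1),
  (fun j => (sval (s j)).2), (fun j => (F (j, s j)).2).
by split; [split => // j|move=> j..]; have [] := FP (j, s j).
Qed.

(** [a 0] is the sum of what the first [N] stages removed and of the residue [a N]; if one residue
    vanishes, everything has been removed. *)
Lemma telescoping_nneseries {R : realType} (a r : nat -> \bar R) :
  (forall j, 0 <= a j)%E -> (forall j, 0 <= r j)%E ->
  (forall j, a j = r j + a j.+1)%E ->
  (\sum_(0 <= j <oo) r j <= a 0%N)%E /\
  ((exists N, a N = 0%E) -> (\sum_(0 <= j <oo) r j)%E = a 0%N).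
Proof.
move=> a0 r0 aE.
have sumE N : a 0%N = (\sum_(0 <= j < N) r j + a N)%E.
  elim: N => [|N IH]; first by rewrite big_nil add0e.
  by rewrite big_nat_recr//= -addeA -aE.
have le_sum : (\sum_(0 <= j <oo) r j <= a 0%N)%E.
  apply: lime_le; first exact: is_cvg_nneseries.
  by apply: nearW => N; rewrite (sumE N) leeDl.
split=> // -[N aN0]; apply/eqP; rewrite eq_le le_sum/= (sumE N) aN0 adde0.
exact: nneseries_lim_ge.
Qed.

(** * Ergodicity and the final coupling *)

Theorem theorem1p2 (R : realType) (d : measure_display) (X : measurableType d)
    (T : X -> X) (mu : {sigma_finite_measure set X -> \bar R})
    (m1 m2 : probability X R) :
  standard_borel R X ->
  measurable_fun [set: X] T ->
  nonsingular mu T ->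
  ergodic mu T ->
  m1 `<< mu ->
  m2 `<< mu ->
  coupled_along_orbits T m1 m2.
Proof.
move=> sX mT nsT ergT /null_content_dominatesP ac1 /null_content_dominatesP ac2.
have [x0 _] : [set: X] !=set0.
  apply/set0P/eqP => X0; have := probability_setT m1.
  by rewrite X0 measure0 => /eqP; rewrite eqe eq_sym oner_eq0.
have [phi [psi [mphi mpsi phiK]]] := standard_borel_real_coding x0 sX.
have mTi n : measurable_fun setT (iter n T) by exact: measurable_iter.
(* One stage for each pair of iterates; an integer that codes no pair repeats the pair [(0, 0)]. *)
pose f j := iter (odflt (0, 0)%N (unpickle j)).1 T.
pose g j := iter (odflt (0, 0)%N (unpickle j)).2 T.
have fE (n k : nat) : f (pickle (n, k)) = iter n T by rewrite /f pickleK.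
have gE (n k : nat) : g (pickle (n, k)) = iter k T by rewrite /g pickleK.
have [rho_ [a [b [S [[a0 b0 mS] aE bE rho_0 ab0]]]]] :=
  partial_coupling_seq mu m1 m2 f g phi psi mphi mpsi phiK
    (fun=> mTi _) (fun=> mTi _)
    (fun j => nonsingular_iter mu T _ mT nsT)
    (fun j => nonsingular_iter mu T _ mT nsT) ac1 ac2.
pose rho : {measure set (X * X)%type -> \bar R} :=
  mseries (fun j => rho_ j : {measure set (X * X)%type -> \bar R}) 0.
have rhoE A : rho A = (\sum_(0 <= j <oo) rho_ j A)%E by [].
have [le1 eq1] : (forall A, measurable A -> (rho (fst @^-1` A) <= m1 A)%E) /\
    (forall j A, measurable A -> a j A = 0%E -> rho (fst @^-1` A) = m1 A).
  have h A mA := telescoping_nneseries (fun j => a j A)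
    (fun j => rho_ j (fst @^-1` A)) (fun=> measure_ge0 _ _)
    (fun=> measure_ge0 _ _) (fun j => aE j A mA).
  split=> [A mA|j A mA ajA]; have [le_a eq_a] := h A mA.
    by rewrite rhoE (le_trans le_a)// a0.
  by rewrite rhoE eq_a ?a0//; exists j.
have [le2 eq2] : (forall A, measurable A -> (rho (snd @^-1` A) <= m2 A)%E) /\
    (forall j A, measurable A -> b j A = 0%E -> rho (snd @^-1` A) = m2 A).
  have h A mA := telescoping_nneseries (fun j => b j A)
    (fun j => rho_ j (snd @^-1` A)) (fun=> measure_ge0 _ _)
    (fun=> measure_ge0 _ _) (fun j => bE j A mA).
  split=> [A mA|j A mA bjA]; have [le_b eq_b] := h A mA.
    by rewrite rhoE (le_trans le_b)// b0.
  by rewrite rhoE eq_b ?b0//; exists j.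
pose nu1 : {measure set X -> \bar R} :=
  measure_function_pushforward__canonical__measure_function_Measure
    rho (measurable_fst : measurable_fun setT (fst : X * X -> X)).
pose nu2 : {measure set X -> \bar R} :=
  measure_function_pushforward__canonical__measure_function_Measure
    rho (measurable_snd : measurable_fun setT (snd : X * X -> X)).
(* The residue after stage [j] has index [j.+1]. It is null on this set, so all the mass of [m1]
   there has been coupled. *)
have E1 (n k : nat) : nu1 (iter n T @^-1` S (pickle (n, k))) =
    m1 (iter n T @^-1` S (pickle (n, k))).
  apply: (eq1 (pickle (n, k)).+1); first exact: measurable_preimage.
  by have [+ _] := ab0 (pickle (n, k)); rewrite fE.
have E2 (n k : nat) : nu2 (iter k T @^-1` (~` S (pickle (n, k)))) =
    m2 (iter k T @^-1` (~` S (pickle (n, k)))).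
  apply: (eq2 (pickle (n, k)).+1).
    by apply: measurable_preimage => //; exact: measurableC.
  by have [_ +] := ab0 (pickle (n, k)); rewrite gE.
(* [A] carries every [iter n T]-image of the residual part of [m1] and is null
   for those of [m2]; its limsup [B] is strictly invariant. *)
pose A := \bigcup_(n in [set: nat]) \bigcap_(k in [set: nat])
  ~` S (pickle (n, k)).
have mA : measurable A.
  apply: bigcup_measurable => n _; apply: bigcap_measurable => // k _.
  exact: measurableC.
pose B := \bigcap_N \bigcup_(i in [set i | (N <= i)%N]) (iter i T @^-1` A).
have mB : measurable B.
  apply: bigcap_measurable => // N _; apply: bigcup_measurable => i _.
  exact: measurable_preimage.
have nu1BC : nu1 (~` B) = m1 (~` B).
  pose E (i : nat) := \bigcup_(k in [set: nat]) iter i T @^-1` S (pickle (i, k)).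
  have mE i : measurable (E i).
    by apply: bigcup_measurable => k _; exact: measurable_preimage.
  apply: (measure_eq_sub m1 nu1 le1 _ (\bigcup_i E i)).
  - exact: measurableC.
  - exact: bigcup_measurable.
  (* Off all the [E i], the point [iter N T x] belongs to [A] for every [N]: the index [n] in [A] is
     taken equal to the time [N]. *)
  - move=> x; apply: contra_notP => nEx N _; exists N => //=.
    by exists N => // k _ Sx; apply: nEx; exists N => //; exists k.
  - apply: measure_eq_bigcup => // i; apply: measure_eq_bigcup => // k.
    exact: measurable_preimage.
have nu2B : nu2 B = m2 B.
  pose E (i : nat) := \bigcup_(n in [set: nat]) iter i T @^-1` (~` S (pickle (n, i))).
  have mE i : measurable (E i).
    apply: bigcup_measurable => k _; apply: measurable_preimage => //.
    exact: measurableC.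
  apply: (measure_eq_sub m2 nu2 le2 _ (\bigcup_i E i)) => //.
  - exact: bigcup_measurable.
  (* A single visit to [A], at time [i], is enough: the intersection over [k] is used at [k = i]. *)
  - by move=> x /(_ 0%N I)[i _ [n _ Sx]]; exists i => //; exists n => //; exact: Sx.
  - apply: measure_eq_bigcup => // i; apply: measure_eq_bigcup => // k.
    by apply: measurable_preimage => //; exact: measurableC.
have splitB (m : {measure set X -> \bar R}) : m setT = (m B + m (~` B))%E.
  by rewrite -(setUv B) measureU// ?setICr//; exact: measurableC.
have null_eq (m nu : {measure set X -> \bar R}) C :
    (nu C <= m C)%E -> m C = 0%E -> nu C = m C.
  by move=> + mC0; rewrite mC0 measure_le0 => /eqP.
(* If [mu B = 0], then [m1] and [nu1] both vanish on [B] and agree off it; in the other case [m2]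
   and [nu2] agree in the same way. Since [nu1] and [nu2] have the total mass of [rho], one full
   marginal settles both. *)
have rhoT : rho setT = 1%E.
  have [B0|BC0] := ergT B mB (limsup_preimage_invariant T A).
  - rewrite -[LHS]/(nu1 setT) -(probability_setT m1) !splitB nu1BC.
    by congr (_ + _)%E; apply: null_eq; [exact: le1|exact: ac1].
  - have mBC : measurable (~` B) by exact: measurableC.
    rewrite -[LHS]/(nu2 setT) -(probability_setT m2) !splitB nu2B.
    by congr (_ + _)%E; apply: null_eq; [exact: le2|exact: ac2].
have nu1E C : measurable C -> nu1 C = m1 C.
  move=> mC; apply: (measure_eq_sub m1 nu1 le1 _ setT) => //.
  exact: etrans rhoT (esym (probability_setT m1)).
have nu2E C : measurable C -> nu2 C = m2 C.
  move=> mC; apply: (measure_eq_sub m2 nu2 le2 _ setT) => //.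
  exact: etrans rhoT (esym (probability_setT m2)).
exists rho; split => //.
(* Each [rho_ j] is null on the set of index [j], hence on the intersection. Outside [N] some pair
   of iterates agrees, since [phi] is injective; stating this through [phi] makes [N] measurable. *)
pose N := \bigcap_j [set p : (X * X)%type | phi (f j p.1) != phi (g j p.2)].
have mNj j : measurable [set p : (X * X)%type | phi (f j p.1) != phi (g j p.2)].
  by apply: measurable_neq; apply: measurableT_comp => //;
    apply: measurableT_comp => //; exact: mTi.
have mN : measurable N by exact: bigcapT_measurable.
exists N; split => //.
- rewrite rhoE; apply: eseries0 => j _ _; apply/eqP.
  rewrite -measure_le0 -(rho_0 j) le_measure ?inE//.
  exact: bigcap_inf.
- move=> p /= np j _ /=; apply/eqP => fg; apply: np.
  by exists (odflt (0, 0)%N (unpickle j)).1, (odflt (0, 0)%N (unpickle j)).2;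
    exact: (can_inj phiK).
Qed.
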